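(* Let $f:\mathbb{R}^n\to\mathbb{R}$ satisfy: (A1) $f$ is continuous and bounded; (A2) $f$ attains its minimum, i.e. with $\underline f:=\min_{z\in\mathbb{R}^n}f(z)$ the set $\mathfrak{M}:=\{x\in\mathbb{R}^n: f(x)=\underline f\}$ is nonempty; (A3) for every $\delta>0$ there exists $\gamma(\delta)>0$ such that $\inf\{f(x)-\underline f:\operatorname{dist}(x,\mathfrak{M})>\delta\}>\gamma(\delta)$. Let $x\in\mathbb{R}^n$ and $\varepsilon>0$. Then for every $\eta>0$ and every $\bar\lambda>0$ there exists $\lambda\in(0,\bar\lambda)$ such that for every $\varepsilon$-optimal trajectory $y_x^{\alpha_\varepsilon}(\cdot)$ starting from $x$ of the infinite-horizon discounted problem with discount $\lambda$ there is some $s\in[0,\infty)$ with $$\operatorname{dist}\big(y_x^{\alpha_\varepsilon}(s),\mathfrak{M}\big)\le\eta.$$ The same result is satisfied by optimal trajectories ($\varepsilon=0$).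
   Context: $\|f\|_\infty=\sup|f|$. Fix a constant $M\ge1+\sqrt{6\|f\|_\infty}$ and let $B_M$ be the closed ball of radius $M$ centered at $0$ in $\mathbb{R}^n$. Admissible controls are measurable functions $\alpha(\cdot):[0,\infty)\to B_M$; the trajectory is $y_x^\alpha(s)=x+\int_0^s\alpha(r)\,dr$. The infinite-horizon discounted problem with discount $\lambda>0$ has value function $$u_\lambda(x)=\inf_\alpha\int_0^\infty\Big(\tfrac12|\alpha(s)|^2+f(y_x^\alpha(s))\Big)e^{-\lambda s}\,ds.$$ For $\varepsilon\ge0$, a trajectory $y_x^{\alpha_\varepsilon}$ with admissible control $\alpha_\varepsilon$ is $\varepsilon$-optimal if $\int_0^\infty(\tfrac12|\alpha_\varepsilon(s)|^2+f(y_x^{\alpha_\varepsilon}(s)))e^{-\lambda s}\,ds\le u_\lambda(x)+\varepsilon$; it is optimal if this holds with $\varepsilon=0$. $\operatorname{dist}(y,\mathfrak{M})=\inf_{z\in\mathfrak{M}}|y-z|$. *)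

(* Defs.v *)
From mathcomp Require Import all_boot all_order all_algebra.
From mathcomp Require Import all_classical all_reals all_analysis.
Set Implicit Arguments.
Unset Strict Implicit.
Unset Printing Implicit Defensive.
Import Order.TTheory GRing.Theory Num.Theory.
Import numFieldNormedType.Exports.

Local Open Scope classical_set_scope.
Local Open Scope ring_scope.

(* The norm that the library puts on 'rV[R]_n is the max norm; it induces the
   same topology, so only metric notions need the Euclidean one. *)
Definition enorm (R : realType) (n : nat) (v : 'rV[R]_n) : R :=
  Num.sqrt (\sum_(i < n) v 0 i ^+ 2).

(* Real infimum: meaningful for A nonempty. *)
Definition dist_to (R : realType) (n : nat) (y : 'rV[R]_n)
    (A : set 'rV[R]_n) : R :=
  inf [set enorm (y - z) | z in A].

Definition sup_norm (R : realType) (n : nat) (f : 'rV[R]_n -> R) : R :=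
  sup (range (fun x => `|f x|)).

(* For f bounded this is the real infimum of f; it is the minimum of f exactly
   when [minimizers f] is nonempty. *)
Definition fmin (R : realType) (n : nat) (f : 'rV[R]_n -> R) : R :=
  inf (range f).

Definition minimizers (R : realType) (n : nat) (f : 'rV[R]_n -> R) :
    set 'rV[R]_n :=
  [set x | f x = fmin f].

(* The infimum is taken in the extended reals, so that it is +oo when no point
   is at distance more than delta from the minimizers. *)
Definition uniform_min_gap (R : realType) (n : nat) (f : 'rV[R]_n -> R) : Prop :=
  forall delta : R, 0 < delta -> exists gamma : R, 0 < gamma /\
    (gamma%:E < ereal_inf [set (f x - fmin f)%:E
                          | x in [set x | delta < dist_to x (minimizers f)]%R])%E.

(* Controls are total functions on R of which only the values on [0, +oo[ are
   constrained and used. *)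
Definition admissible (R : realType) (n : nat) (M : R)
    (alpha : R -> 'rV[R]_n) : Prop :=
  (forall i : 'I_n, measurable_fun (`[0, +oo[ : set R) (fun s : R => alpha s 0 i)) /\
  (forall s : R, 0 <= s -> enorm (alpha s) <= M).

Definition trajectory (R : realType) (n : nat) (x : 'rV[R]_n)
    (alpha : R -> 'rV[R]_n) (s : R) : 'rV[R]_n :=
  x + \row_(i < n) \int[@lebesgue_measure R]_(r in `[0, s]) (alpha r 0 i).

Definition cost (R : realType) (n : nat) (f : 'rV[R]_n -> R) (lambda : R)
    (x : 'rV[R]_n) (alpha : R -> 'rV[R]_n) : R :=
  \int[@lebesgue_measure R]_(s in `[0, +oo[)
    ((2^-1 * enorm (alpha s) ^+ 2 + f (trajectory x alpha s))
     * expR (- (lambda * s))).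

(* For f bounded and lambda > 0 the integrands of [cost] are integrable and the
   costs of admissible controls are bounded below, so the real-valued integral
   and infimum take their usual values. *)
Definition value (R : realType) (n : nat) (f : 'rV[R]_n -> R) (M lambda : R)
    (x : 'rV[R]_n) : R :=
  inf [set cost f lambda x alpha | alpha in [set alpha | admissible M alpha]].

Definition eps_optimal (R : realType) (n : nat) (f : 'rV[R]_n -> R)
    (M lambda eps : R) (x : 'rV[R]_n) (alpha : R -> 'rV[R]_n) : Prop :=
  admissible M alpha /\ cost f lambda x alpha <= value f M lambda x + eps.

(* Main.v *)
Require Import Defs.
From mathcomp Require Import all_boot all_order all_algebra.
From mathcomp Require Import all_classical all_reals all_analysis measurable_realfun.
Import Order.TTheory GRing.Theory Num.Theory.
Import numFieldNormedType.Exports.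
Local Open Scope classical_set_scope.
Local Open Scope ring_scope.

(** Two estimates of the cost are compared as the discount [lambda] tends to 0.

    From [x] one can travel in a straight line at speed at most 1 to a
    minimizer [z] of [f], arriving at time [T = |z - x| + 1], and rest there.
    After arrival the running cost is [fmin f]; before, it exceeds [fmin f] by
    at most the constant [2^-1 + F - fmin f], where [F] bounds [|f|].  Hence
    [value f M lambda x <= fmin f / lambda + A] with [A] independent of
    [lambda] (lemma [value_le]).

    A trajectory that stays at distance more than [eta] from the minimizers
    sees [f >= fmin f + gamma] at all times, with [gamma > 0] given by
    the gap assumption, so it costs at least [(fmin f + gamma) / lambda] (lemma
    [cost_ge]).  If its control is [eps]-optimal, then
    [gamma / lambda <= A + eps], which fails as soon as
    [lambda < gamma / (A + eps)].  So for such a [lambda] every [eps]-optimal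
    trajectory comes within [eta] of the minimizers, [eps = 0] included.

    Comparing integrals requires the running cost of an arbitrary admissible
    control to be integrable against the discount; its measurability
    comes from the continuity of trajectories. *)

Set Implicit Arguments.
Unset Strict Implicit.
Unset Printing Implicit Defensive.

Local Notation mu := lebesgue_measure.

(** * The Euclidean norm *)

Lemma enormZ (R : realType) (n : nat) (c : R) (v : 'rV[R]_n) :
  0 <= c -> enorm (c *: v) = c * enorm v.
Proof.
move=> c0; rewrite /enorm; under eq_bigr do rewrite mxE exprMn.
by rewrite -mulr_sumr sqrtrM ?sqr_ge0// sqrtr_sqr ger0_norm.
Qed.

Lemma le_coord_enorm (R : realType) (n : nat) (v : 'rV[R]_n) (i : 'I_n) :
  `|v 0 i| <= enorm v.
Proof.
rewrite -sqrtr_sqr ler_wsqrtr// (bigD1 i)//= lerDl.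
by apply: sumr_ge0 => j _; exact: sqr_ge0.
Qed.

(** * Integrals of the exponential discount *)

Section discount.
Variables (R : realType) (lambda : R).
Hypothesis lambda_gt0 : 0 < lambda.

Let expE : {in `[0, +oo[%classic, forall s,
  exponential_pdf lambda s = lambda * expR (- (lambda * s))}.
Proof. by move=> s s0; rewrite /exponential_pdf patchE s0 mulNr. Qed.

Let expI : (@mu R).-integrable `[0, +oo[ (EFin \o exponential_pdf lambda).
Proof.
by apply: integrableS (integrable_exponential_pdf lambda_gt0).
Qed.

(** Up to the factor [lambda], the discount is the density of the exponential
    distribution, whose integral is known. *)
Lemma integrable_discount (m : R) : (@mu R).-integrable `[0, +oo[
  (EFin \o (fun s => m * expR (- (lambda * s)))).
Proof.
have : (@mu R).-integrable `[0, +oo[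
    (fun s => (m / lambda)%:E * (EFin \o exponential_pdf lambda) s)%E.
  exact: integrableZl.
apply: eq_integrable => // s s0 /=.
by rewrite expE// -EFinM mulrA divfK ?gt_eqF.
Qed.

Lemma Rintegral_discount (m : R) :
  \int[@mu R]_(s in `[0, +oo[) (m * expR (- (lambda * s))) = m / lambda.
Proof.
have -> : \int[@mu R]_(s in `[0, +oo[) (m * expR (- (lambda * s))) =
    \int[@mu R]_(s in `[0, +oo[) (m / lambda * exponential_pdf lambda s).
  apply: eq_Rintegral => s s0.
  by rewrite expE// mulrA divfK ?gt_eqF.
rewrite RintegralZl// Rintegral_mkcond.
rewrite [X in _ * X](_ : _ = \int[@mu R]_s exponential_pdf lambda s).
  by rewrite /Rintegral integral_exponential_pdf ?mulr1// ltW.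
apply: eq_Rintegral => s _; rewrite patchE; case: ifPn => // s0.
by rewrite /exponential_pdf patchE (negbTE s0).
Qed.

End discount.

(** * Costs of admissible controls *)

Section admissible_controls.
Variables (R : realType) (n : nat) (M : R) (alpha : R -> 'rV[R]_n).
Hypothesis alphaM : admissible M alpha.

Lemma admissible_integrable (b : R) (i : 'I_n) :
  (@mu R).-integrable `[0, b] (EFin \o (fun s => alpha s 0 i)).
Proof.
case: alphaM => alpham alphab.
apply: measurable_bounded_integrable => //.
- by rewrite /= lebesgue_measure_itv/=; case: ifP => _; rewrite ltry.
- by apply: measurable_funS (alpham i) => // s /=; rewrite !in_itv/= => /andP[->].
- exists M; split => [|B MB s]; first exact: num_real.
  rewrite /= in_itv/= => /andP[s0 _].
  exact: le_trans (le_coord_enorm _ _) (le_trans (alphab _ s0) (ltW MB)).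
Qed.

(** Each coordinate is the primitive of a bounded function.  Time 0 is left
    out since the primitive is only handled inside an interval [[0, s + 1]];
    a single instant does not affect measurability. *)
Lemma continuous_trajectory (x : 'rV[R]_n) (s : R) : 0 < s ->
  {for s, continuous (trajectory x alpha)}.
Proof.
move=> s0; pose I t : 'rV[R]_n :=
  \row_i \int[@mu R]_(r in `[0, t]) (alpha r 0 i).
suff cI : I t @[t --> s] --> I s.
  by rewrite /continuous_at /trajectory; apply: cvgD; [exact: cvg_cst|exact: cI].
have cIi i : I t 0 i @[t --> s] --> I s 0 i.
  have /= : {within `[0, s + 1], continuous (fun t => I t 0 i)}.
    rewrite (_ : (fun t => _) =
      fun t => parameterized_integral (@mu R) 0 t (fun r => alpha r 0 i)).
      apply: parameterized_integral_continuous; last exact: admissible_integrable.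
      by rewrite addr_ge0// ltW.
    by apply/funext => t; rewrite mxE.
  move/within_continuous_continuous; apply.
    by rewrite addr_gt0.
  by rewrite in_itv/= s0 ltrDl ltr01.
apply/cvg_ballP => e e0.
have near_s : \forall t \near s, forall i, ball (I s 0 i) e (I t 0 i).
  apply: (@filter_forall _ _ (fun i t => ball (I s 0 i) e (I t 0 i)) (nbhs s)
    (nbhs_filter s)) => i.
  exact: (cvg_ball (cIi i)).
by apply: filterS near_s => t tI; split => // j i; rewrite (ord1 j); exact: tI.
Qed.

Lemma measurable_trajectory (f : 'rV[R]_n -> R) (x : 'rV[R]_n) :
  continuous f ->
  measurable_fun (`[0, +oo[ : set R) (fun s => f (trajectory x alpha s)).
Proof.
move=> fc; apply/measurable_fun_itv_obnd_cbndP.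
apply: open_continuous_measurable_fun => // s.
rewrite inE/= in_itv/= andbT => s0.
by apply: continuous_comp; [exact: continuous_trajectory|exact: fc].
Qed.

Lemma measurable_enorm_sqr :
  measurable_fun (`[0, +oo[ : set R) (fun s => enorm (alpha s) ^+ 2).
Proof.
rewrite (_ : (fun s => _) = fun s => \sum_(i < n) alpha s 0 i ^+ 2).
  by apply: measurable_sum => i; apply: measurable_funX; case: alphaM.
by apply/funext => s; rewrite sqr_sqrtr// sumr_ge0// => i _; exact: sqr_ge0.
Qed.

(** The running cost is bounded, because the ball of admissible velocities and
    [f] are, so it is dominated by a multiple of the discount. *)
Lemma integrable_running_cost (f : 'rV[R]_n -> R) (F : R) (lambda : R)
    (x : 'rV[R]_n) :
  continuous f -> (forall y, `|f y| <= F) -> 0 < lambda ->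
  (@mu R).-integrable `[0, +oo[ (EFin \o (fun s =>
    (2^-1 * enorm (alpha s) ^+ 2 + f (trajectory x alpha s))
      * expR (- (lambda * s)))).
Proof.
move=> fc fF lambda0.
have idisc := integrable_discount lambda0 (2^-1 * M ^+ 2 + F).
apply: le_integrable idisc => //.
- apply/measurable_EFinP; apply: measurable_funM.
    apply: measurable_funD; last exact: measurable_trajectory.
    by apply: measurable_funM => //; exact: measurable_enorm_sqr.
  apply: measurableT_comp => //.
  by apply: measurableT_comp => //; exact: measurable_funM.
- move=> s /=; rewrite in_itv/= andbT => s0.
  case: alphaM => _ /(_ s s0) aM.
  have e0 : 0 <= enorm (alpha s) by exact: sqrtr_ge0.
  rewrite lee_fin !normrM ler_wpM2r//.
  apply: le_trans (ler_normD _ _) _; apply: le_trans (ler_norm _).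
  rewrite lerD// ger0_norm ?mulr_ge0 ?sqr_ge0//.
  by rewrite ler_wpM2l// lerXn2r// nnegrE// (le_trans e0).
Qed.

(** The kinetic term is nonnegative and the discount has total mass
    [1 / lambda]. *)
Lemma cost_ge (f : 'rV[R]_n -> R) (F m lambda : R) (x : 'rV[R]_n) :
  continuous f -> (forall y, `|f y| <= F) -> 0 < lambda ->
  (forall s, 0 <= s -> m <= f (trajectory x alpha s)) ->
  m / lambda <= cost f lambda x alpha.
Proof.
move=> fc fF lambda0 mf; rewrite -Rintegral_discount//.
apply: le_Rintegral => //.
- exact: integrable_discount.
- exact: integrable_running_cost fc fF lambda0.
- move=> s /=; rewrite in_itv/= andbT => s0.
  rewrite ler_wpM2r ?expR_ge0// (le_trans (mf _ s0))// lerDr.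
  by rewrite mulr_ge0 ?sqr_ge0.
Qed.

(** An excess [K] over the level [m] that lasts only until time [T] costs at
    most [K * T], uniformly in [lambda], since the discount is at most 1. *)
Lemma cost_le (f : 'rV[R]_n -> R) (F m K T lambda : R) (x : 'rV[R]_n) :
  continuous f -> (forall y, `|f y| <= F) -> 0 < lambda -> 0 <= K -> 0 <= T ->
  (forall s, 0 <= s -> s <= T ->
     2^-1 * enorm (alpha s) ^+ 2 + f (trajectory x alpha s) <= m + K) ->
  (forall s, T < s ->
     2^-1 * enorm (alpha s) ^+ 2 + f (trajectory x alpha s) <= m) ->
  cost f lambda x alpha <= m / lambda + K * T.
Proof.
move=> fc fF lambda0 K0 T0 before after.
have muT : mu `[0, T]%classic = T%:E :> \bar R.
  rewrite lebesgue_measure_itv/= lte_fin oppr0 addr0.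
  by move: T0; rewrite le_eqVlt => /predU1P[<-|->]//; rewrite ltxx.
have cap : `[0, +oo[ `&` `[0, T] = `[0, T]%classic :> set R.
  apply/seteqP; split => [s []//|s /= sT]; split => //.
  by move: sT; rewrite !in_itv/= andbT => /andP[].
have idisc := integrable_discount lambda0 m.
have iK : (@mu R).-integrable `[0, +oo[
    (EFin \o ((fun=> K) \_ (`[0, T] : set R))).
  rewrite -restrict_EFin; apply/integrable_restrict => //.
  rewrite cap; apply: measurable_bounded_integrable => //.
    by rewrite /= muT ltry.
  by exists K; split => [|B /ltW KB s _]; rewrite ?num_real// ger0_norm.
have -> : m / lambda + K * T = \int[@mu R]_(s in `[0, +oo[)
    (m * expR (- (lambda * s)) + ((fun=> K) \_ (`[0, T] : set R)) s).
  rewrite RintegralD// Rintegral_discount//; congr (_ + _).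
  by rewrite -Rintegral_mkcondr cap Rintegral_cst//= muT.
apply: le_Rintegral => //.
- exact: integrable_running_cost fc fF lambda0.
- rewrite (_ : _ \o _ = (EFin \o (fun s => m * expR (- (lambda * s)))) \+
    (EFin \o ((fun=> K) \_ (`[0, T] : set R)))); last exact/funext.
  exact: integrableD.
- move=> s /=; rewrite in_itv/= andbT => s0; rewrite patchE.
  have E0 := expR_ge0 (- (lambda * s)).
  case: ifPn => [|sT].
    rewrite inE/= in_itv/= => /andP[_ sT].
    apply: le_trans (ler_wpM2r E0 (before _ s0 sT)) _.
    rewrite mulrDl lerD2l ler_piMr//.
    by rewrite -expR0 ler_expR oppr_le0 mulr_ge0// ltW.
  rewrite addr0 ler_wpM2r// after// ltNge; apply: contra sT => sT.
  by rewrite inE/= in_itv/= s0.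
Qed.

End admissible_controls.

(** * Steering to a minimizer *)

Definition steer (R : realType) (n : nat) (T : R) (v : 'rV[R]_n) (s : R) :
    'rV[R]_n :=
  if s <= T then T^-1 *: v else 0.

Lemma admissible_steer (R : realType) (n : nat) (M T : R) (v : 'rV[R]_n) :
  0 <= M -> 0 < T -> enorm v <= M * T -> admissible M (steer T v).
Proof.
move=> M0 T0 vT; split => [i|s _].
- rewrite (_ : (fun s => _) =
    (fun s => if s <= T then (T^-1 *: v) 0 i else 0)).
    by apply: measurable_fun_if => //; exact: measurable_fun_ler.
  by apply/funext => s; rewrite /steer; case: ifP => // _; rewrite mxE.
- rewrite /steer; case: ifP => _.
    by rewrite enormZ ?invr_ge0 ?(ltW T0)// ler_pdivrMl// mulrC.
  by rewrite -(scale0r v) enormZ// mul0r.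
Qed.

Lemma trajectory_steer (R : realType) (n : nat) (T s : R) (x z : 'rV[R]_n) :
  0 < T -> T <= s -> trajectory x (steer T (z - x)) s = z.
Proof.
move=> T0 Ts; apply/rowP => i; rewrite !mxE.
have -> : \int[@mu R]_(r in `[0, s]) (steer T (z - x) r 0 i) =
    \int[@mu R]_(r in `[0, T]) (T^-1 * (z - x) 0 i).
  rewrite (_ : `[0, T]%classic = `[0, s] `&` `]-oo, T]).
    rewrite Rintegral_mkcondr; apply: eq_Rintegral => r _.
    rewrite patchE /steer; case: ifPn => rT; case: ifPn => //.
    - by rewrite mxE.
    - by rewrite notin_setE/= in_itv/= rT.
    - by rewrite inE/= in_itv/= (negbTE rT).
    - by rewrite mxE.
  apply/seteqP; split => r /=; rewrite !in_itv/=.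
    by move=> /andP[-> rT]; rewrite rT (le_trans rT).
  by case=> /andP[-> _].
rewrite Rintegral_cst//= lebesgue_measure_itv/= lte_fin T0/= oppr0 addr0.
by rewrite mulrAC mulVf ?gt_eqF// mul1r !mxE addrC subrK.
Qed.

(** * The value function, and visits near the minimizers *)

Section value_function.
Variables (R : realType) (n : nat) (f : 'rV[R]_n -> R) (F : R).
Hypotheses (f_cont : continuous f) (fF : forall y, `|f y| <= F).

Lemma fmin_le (y : 'rV[R]_n) : fmin f <= f y.
Proof.
apply: ge_inf; last by exists y.
by exists (- F) => _ [u _ <-]; have := fF u; rewrite ler_norml => /andP[].
Qed.

(** The control steering [x] to [z] in time [|z - x| + 1] has speed at most 1;
    the extra 1 keeps the travel time positive when [x = z]. *)
Lemma value_le (M lambda : R) (x z : 'rV[R]_n) :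
  1 <= M -> minimizers f z -> 0 < lambda ->
  value f M lambda x <=
    fmin f / lambda + (2^-1 + F - fmin f) * (enorm (z - x) + 1).
Proof.
move=> M1 zmin lambda0; pose T := enorm (z - x) + 1.
have d0 : 0 <= enorm (z - x) by exact: sqrtr_ge0.
have T0 : 0 < T by rewrite ltr_wpDl.
have dT : enorm (z - x) <= 1 * T by rewrite mul1r lerDl.
(* Admissibility for the unit ball is what bounds the kinetic term by 1/2. *)
have adm1 := admissible_steer ler01 T0 dT.
have admM : admissible M (steer T (z - x)).
  by case: adm1 => ? b; split => // s s0; exact: le_trans (b s s0) M1.
have fminF : fmin f <= F.
  exact: le_trans (fmin_le z) (le_trans (ler_norm _) (fF z)).
apply: (@le_trans _ _ (cost f lambda x (steer T (z - x)))).
  (* [ge_inf] needs the set of costs to be bounded below. *)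
  apply: ge_inf; last by exists (steer T (z - x)).
  exists (fmin f / lambda) => _ [a aM <-].
  by apply: (cost_ge aM f_cont fF lambda0) => s _; exact: fmin_le.
apply: (cost_le adm1 f_cont fF lambda0).
- by rewrite -addrA addr_ge0// subr_ge0.
- exact: ltW.
- move=> s s0 _; rewrite [leRHS]addrC subrK lerD//; last first.
    exact: le_trans (ler_norm _) (fF _).
  case: adm1 => _ /(_ s s0) b; rewrite ler_piMr//.
  by rewrite expr_le1// sqrtr_ge0.
- move=> s Ts.
  rewrite trajectory_steer ?(ltW Ts)// zmin /steer [s <= T]leNgt Ts/=.
  by rewrite -(scale0r (z - x)) enormZ// mul0r expr0n/= mulr0 add0r.
Qed.

End value_function.

Theorem corollary3p5 (R : realType) (n : nat) (f : 'rV[R]_n -> R) (M : R)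
    (f_cont : continuous f) (f_bounded : bounded_fun f)
    (f_min : minimizers f !=set0) (f_gap : uniform_min_gap f)
    (M_ge : 1 + Num.sqrt (6 * sup_norm f) <= M)
    (x : 'rV[R]_n) (eps : R) (eps_ge0 : 0 <= eps)
    (eta : R) (eta_gt0 : 0 < eta)
    (lambda_bar : R) (lambda_bar_gt0 : 0 < lambda_bar) :
  exists lambda : R, 0 < lambda < lambda_bar /\
    forall alpha : R -> 'rV[R]_n, eps_optimal f M lambda eps x alpha ->
      exists s : R, 0 <= s /\
        dist_to (trajectory x alpha s) (minimizers f) <= eta.
Proof.
have [F fF] : exists F : R, forall y, `|f y| <= F.
  case: f_bounded => B [_ fB]; exists (B + 1) => y.
  by apply: fB => //; rewrite ltrDl.
have M1 : 1 <= M by rewrite (le_trans _ M_ge)// lerDl sqrtr_ge0.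
have [z zmin] := f_min.
have [gamma [gamma0 gap]] := f_gap eta eta_gt0.
pose C := (2^-1 + F - fmin f) * (enorm (z - x) + 1) + eps.
have fminF : fmin f <= F.
  exact: le_trans (fmin_le fF z) (le_trans (ler_norm _) (fF z)).
have C0 : 0 <= C.
  have K0 : 0 <= 2^-1 + F - fmin f by rewrite -addrA addr_ge0// subr_ge0.
  have d0 : 0 <= enorm (z - x) + 1 by rewrite addr_ge0// sqrtr_ge0.
  exact: addr_ge0 (mulr_ge0 K0 d0) eps_ge0.
(* [C + 1] instead of [C] keeps the denominator positive and the final
   comparison strict. *)
pose lambda := Num.min (lambda_bar / 2) (gamma / (C + 1)).
have lambda0 : 0 < lambda.
  by rewrite lt_min !divr_gt0// ltr_wpDl.
exists lambda; split.
  by rewrite lambda0 gt_min ltr_pdivrMr// ltr_pMr// ltr1n.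
move=> alpha [alphaM opt]; apply: contrapT => far.
have gapf s : 0 <= s -> fmin f + gamma <= f (trajectory x alpha s).
  move=> s0; have etad : eta < dist_to (trajectory x alpha s) (minimizers f).
    by rewrite ltNge; apply/negP => near; apply: far; exists s.
  rewrite addrC -lerBrDr -lee_fin (le_trans (ltW gap))//.
  by apply: ereal_inf_lbound; exists (trajectory x alpha s).
have := cost_ge alphaM f_cont fF lambda0 gapf.
move/le_trans => /(_ _ opt); apply/negP; rewrite -ltNge.
have := value_le f_cont fF x M1 zmin lambda0.
rewrite -(lerD2r eps) => /le_lt_trans; apply.
rewrite -addrA -/C mulrDl ltrD2l ltr_pdivlMr//.
apply: (@lt_le_trans _ _ ((C + 1) * lambda)).
  by rewrite ltr_pM2r// ltrDl.
by rewrite mulrC -ler_pdivlMr ?ltr_wpDl// ge_min lexx orbT.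
Qed.
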